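(* Let $t_0\geq 1$ and let $f:[t_0,+\infty)\times\mathbb{R}\to\mathbb{R}$ be a continuous function whose partial derivative $\frac{\partial f}{\partial v}(t,v)$ exists and is continuous in $[t_0,+\infty)\times\mathbb{R}$. Suppose that for all $t\geq t_0$ and $v\in\mathbb{R}$ $$v f(t,v)\leq 0,\qquad \frac{\partial f}{\partial v}(t,v)\leq 0,$$ and $$|f(t,v)|\leq a(t)\,g(|v|),$$ where the functions $a:[t_0,+\infty)\to[0,+\infty)$ and $g:[0,+\infty)\to[0,+\infty)$ are continuous, $g(\alpha)>0$ for every $\alpha>0$, $g$ is monotone nondecreasing, and $$K=\int_{t_0}^{+\infty}t\,a(t)\,dt<+\infty,\qquad \int_{1}^{+\infty}\frac{d\xi}{g(\xi)}<+\infty.$$ Let $x$ be any solution of the equation $$x''+f\left(t,\frac{x}{t}\right)=0,\qquad t\geq t_0,$$ and set $u_0=t_0x'(t_0)-x(t_0)$, $v_0=\frac{x(t_0)}{t_0}$, $c=1+\frac{u_0^2}{2}$. If $$\frac{4}{t_0}\left(K+\frac{c}{g(1)}\right)<\int_{1+|v_0|}^{+\infty}\frac{d\xi}{g(\xi)},$$ then $x$ is defined on $[t_0,+\infty)$ and either $x(t)=o(t)$ when $t\to+\infty$, or there exist $x_1,x_2\in\mathbb{R}$ with $x_1\neq 0$ such that $x(t)=x_1t+x_2+o(1)$ when $t\to+\infty$.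
   Context: A solution of the equation means a $C^2$ real-valued function $x$ satisfying the equation on its maximal interval of existence to the right of $t_0$, i.e. on an interval $[t_0,T_\infty)$ with $t_0<T_\infty\leq+\infty$, such that $x$ cannot be extended as a solution beyond $T_\infty$. *)

(* Defs.v *)
From Stdlib Require Export Reals.
From Coquelicot Require Export Coquelicot.
Open Scope R_scope.

Definition Ico (t0 : R) (T : Rbar) (t : R) : Prop := t0 <= t /\ Rbar_lt t T.

(* [is_derive] with [locally t] replaced by its trace on [D]; this is the
   one-sided derivative at an endpoint of an interval [D]. *)
Definition is_derive_within (D : R -> Prop) (x : R -> R) (t l : R) : Prop :=
  filterdiff x (within D (locally t)) (fun h : R => scal h l).

Definition C2_derivatives (D : R -> Prop) (x dx ddx : R -> R) : Prop :=
  (forall t, D t -> is_derive_within D x t (dx t)) /\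
  (forall t, D t -> is_derive_within D dx t (ddx t)) /\
  continuous_on D ddx.

(* C^2 solution on [t0, T) of x'' + f(t, x/t) = 0. The values of [x] outside
   [t0, T) are irrelevant. *)
Definition solution (f : R -> R -> R) (t0 : R) (T : Rbar) (x : R -> R) : Prop :=
  Rbar_lt t0 T /\
  exists dx ddx : R -> R,
    C2_derivatives (Ico t0 T) x dx ddx /\
    (forall t, Ico t0 T t -> ddx t + f t (x t / t) = 0).

Definition maximal_solution (f : R -> R -> R) (t0 : R) (T : Rbar) (x : R -> R)
  : Prop :=
  solution f t0 T x /\
  forall (T' : Rbar) (y : R -> R),
    Rbar_lt T T' -> solution f t0 T' y ->
    ~ (forall t, Ico t0 T t -> y t = x t).

(* Landau's u = o(w) at +oo. [is_domin] takes the dominating function first. *)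
Definition little_o_pinfty (u w : R -> R) : Prop :=
  is_domin (Rbar_locally p_infty) w u.

(* Main.v *)
Require Import Defs.
From Stdlib Require Import Lra Psatz.

(** Put [v = x / t] and [u = t x' - x]. The equation becomes the first-order system
    [v' = u / t ^ 2], [u' = - t f(t, v)], whose right-hand sides are integrable in time
    as long as [v] and [u] stay bounded; everything follows from such bounds.

    The bounds come from a Bihari inequality ([a_priori_bound]). Let
    [w(t) = 1 + |v(t0)| + int_t0^t |u| / s ^ 2 ds], which dominates [|v|]. As [g] is nondecreasing,
    [|u(t)| <= |u(t0)| + K g(w(t)) <= C g(w(t))] with [C = K + c / g(1)], hence
    [w' <= C g(w) / t ^ 2]. Separating variables, the integral of [1 / g] from [w(t0)] to [w(t)]
    is less than [C / t0], which is less than the integral of [1 / g] up to infinity: [w] is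
    bounded, and so are [v] and [u], independently of the interval of existence.

    If [T] were finite, [v] would be Lipschitz up to [T], so that [x] and [x'] would have
    limits there, and the solution could be continued ([continuation]) by a local solution
    of the equation ([local_existence], by Picard's contraction), which contradicts maximality.

    If [T] is infinite, then [u' = O(t a(t))] and [v' = O(1 / t ^ 2)] are integrable, so [u] and
    [v] tend to limits [u1] and [v1] ([asymptotics]). Moreover [v = v1 - u1 / t + o(1 / t)], by
    integration of [v'] from [t] to infinity, that is [x = v1 t - u1 + o(1)]; and if [v1 = 0], then
    [x = t v = o(t)].

    One-sided derivatives at [t0] are dealt with once and for all by [C2_extension_left]:
    the solution is the restriction of a function that is C2 on the whole half-line
    below [T]. *)

(** * Continuity and primitives *)

Lemma continuous_on_comp {U V : UniformSpace} (D : U -> Prop) (f : U -> V)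
  (phi : R -> U) (t : R) :
  continuous_on D f -> continuous phi t -> D (phi t) ->
  locally t (fun s => D (phi s)) -> continuous (fun s => f (phi s)) t.
Proof.
  intros Hf Hphi Dt HD P HP.
  specialize (Hf _ Dt P HP). unfold filtermap, within in Hf.
  specialize (Hphi _ Hf). unfold filtermap in *.
  generalize (filter_and _ _ HD Hphi). apply filter_imp. tauto.
Qed.

Lemma continuous_Rmax_l (a t : R) : continuous (Rmax a) t.
Proof.
  apply (continuous_ext (fun s => (a + s + Rabs (s - a)) / 2)).
  { intros s; unfold Rmax, Rabs; destruct (Rle_dec a s);
      destruct (Rcase_abs (s - a)); lra. }
  apply (continuous_scal_l (fun s => a + s + Rabs (s - a)) (/ 2)).
  apply (continuous_plus (V := R_NormedModule) (fun s => a + s)).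
  - apply (continuous_plus (V := R_NormedModule) (fun _ => a));
      [apply continuous_const|apply continuous_id].
  - apply continuous_Rabs_comp.
    apply (continuous_minus (V := R_NormedModule) (fun s : R => s) (fun _ => a));
      [apply continuous_id|apply continuous_const].
Qed.

Lemma continuous_Rmin_l (a t : R) : continuous (Rmin a) t.
Proof.
  apply (continuous_ext (fun s => - Rmax (- a) (- s))).
  { intros s; rewrite <- Ropp_Rmin, Ropp_involutive; reflexivity. }
  apply (continuous_opp (V := R_NormedModule) (fun s : R => Rmax (- a) (- s))).
  apply (continuous_comp (fun s => - s) (Rmax (- a))).
  - apply (continuous_opp (V := R_NormedModule) (fun s : R => s)), continuous_id.
  - apply continuous_Rmax_l.
Qed.

Lemma Rbar_lt_near (t : R) (T : Rbar) :
  Rbar_lt t T -> locally t (fun s => Rbar_lt s T).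
Proof. apply open_Rbar_lt. Qed.

Lemma Ico_between (t0 t s : R) (T : Rbar) :
  t0 <= s <= t -> Rbar_lt t T -> Ico t0 T s.
Proof. intros [H1 H2] Ht; split; [exact H1|]. destruct T; simpl in *; try easy; lra. Qed.

Lemma Rbar_lt_Rmax (t0 t : R) (T : Rbar) :
  Rbar_lt t0 T -> Rbar_lt t T -> Rbar_lt (Rmax t0 t) T.
Proof. unfold Rmax; destruct (Rle_dec t0 t); easy. Qed.

Lemma continuous_Ico_Rmax (y : R -> R) (t0 t : R) (T : Rbar) :
  continuous_on (Ico t0 T) y -> Rbar_lt t0 T -> Rbar_lt t T ->
  continuous (fun s => y (Rmax t0 s)) t.
Proof.
  intros Hy H0 Ht. apply (continuous_on_comp (Ico t0 T) y (Rmax t0)); auto.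
  - apply continuous_Rmax_l.
  - split; [apply Rmax_l|now apply Rbar_lt_Rmax].
  - generalize (Rbar_lt_near _ _ Ht). apply filter_imp. intros s Hs.
    split; [apply Rmax_l|now apply Rbar_lt_Rmax].
Qed.

Lemma is_derive_value (y : R -> R) (t l l' : R) :
  is_derive y t l -> l = l' -> is_derive y t l'.
Proof. now intros H <-. Qed.

Lemma is_derive_R_continuous (y : R -> R) (t l : R) : is_derive y t l -> continuous y t.
Proof. intros H. apply (ex_derive_continuous y). now exists l. Qed.

Lemma is_derive_primitive (q : R -> R) (t0 t : R) (T : Rbar) :
  (forall s : R, Rbar_lt s T -> continuous q s) -> Rbar_lt t0 T -> Rbar_lt t T ->
  is_derive (fun s => RInt q t0 s) t (q t).
Proof.
  intros Hq H0 Ht. apply (is_derive_RInt q _ t0); [|now apply Hq].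
  generalize (Rbar_lt_near _ _ Ht). apply filter_imp. intros s Hs.
  apply (RInt_correct (V := R_CompleteNormedModule)),
    (ex_RInt_continuous (V := R_CompleteNormedModule)).
  intros r [_ Hr]. apply Hq.
  generalize (Rbar_lt_Rmax _ _ _ H0 Hs); destruct T; simpl; try easy; lra.
Qed.

(** * One-sided derivatives *)

Lemma is_derive_is_derive_within (D : R -> Prop) (y : R -> R) (t l : R) :
  D t -> is_derive y t l -> is_derive_within D y t l.
Proof.
  intros Dt H.
  apply (@filterdiff_locally R_AbsRing R_NormedModule R_NormedModule) with t.
  - apply Build_ProperFilter; [|apply within_filter, locally_filter].
    intros P HP. exists t. apply (locally_singleton _ _ HP), Dt.
  - intros P HP. now apply filter_le_within.
  - exact H.
Qed.

Lemma is_derive_within_eps (D : R -> Prop) (y : R -> R) (t l : R) :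
  is_derive_within D y t l -> forall eps : posreal,
  locally t (fun s => D s -> Rabs (y s - y t - l * (s - t)) <= eps * Rabs (s - t)).
Proof.
  intros [_ H] eps.
  assert (Hl : is_filter_lim (within D (locally t)) t)
    by (intros P HP; now apply filter_le_within).
  generalize (H t Hl eps). unfold within. apply filter_imp. intros s Hs Ds.
  specialize (Hs Ds). revert Hs. unfold norm, minus, scal, plus, opp; simpl.
  unfold mult, abs; simpl. intros Hs.
  replace (y s - y t - l * (s - t)) with (y s + - y t + - ((s + - t) * l)) by ring.
  exact Hs.
Qed.

(** Near an interior point of [D] the trace filter is the full neighbourhood filter. *)
Lemma is_derive_within_interior (D : R -> Prop) (y : R -> R) (t l : R) :
  locally t D -> is_derive_within D y t l -> is_derive y t l.
Proof.
  intros HD [Hl H]. split; [exact Hl|]. intros s Hs eps.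
  assert (Hs' : is_filter_lim (within D (locally t)) s)
    by (intros P HP; apply filter_le_within; now apply Hs).
  generalize (filter_and _ _ HD (H s Hs' eps)). apply filter_imp. tauto.
Qed.

Lemma is_derive_within_continuous_on (D : R -> Prop) (y dy : R -> R) :
  (forall t, D t -> is_derive_within D y t (dy t)) -> continuous_on D y.
Proof.
  intros H t Dt. apply (filterdiff_continuous_aux (F := within D (locally t)) y).
  - eexists; exact (H t Dt).
  - intros P HP; now apply filter_le_within.
Qed.

(** At an arbitrary point of an arbitrary [D] a derivative within [D] need not be
    unique; at [t0] it is, because [Ico t0 T] contains points [t0 + h] with [h] as
    small as desired, and two candidates would differ by at most [2 * eps] there. *)
Lemma is_derive_within_Ico_unique (t0 : R) (T : Rbar) (y : R -> R) (l1 l2 : R) :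
  Rbar_lt t0 T -> is_derive_within (Ico t0 T) y t0 l1 ->
  is_derive_within (Ico t0 T) y t0 l2 -> l1 = l2.
Proof.
  intros H0 H1 H2. destruct (Req_dec l1 l2) as [|Hne]; [assumption|exfalso].
  (* with a quarter of the gap as tolerance, the two errors add up to at most
     half of the gap *)
  assert (He : 0 < Rabs (l1 - l2) / 4) by (generalize (Rabs_pos_lt (l1 - l2)); lra).
  set (eps := mkposreal _ He).
  generalize (filter_and _ _ (Rbar_lt_near _ _ H0)
    (filter_and _ _ (is_derive_within_eps _ _ _ _ H1 eps)
                    (is_derive_within_eps _ _ _ _ H2 eps))).
  intros [d Hd]. destruct d as [d dpos]; simpl in Hd.
  destruct (Hd (t0 + d / 2)) as [Hs [E1 E2]].
  { unfold ball; simpl; unfold AbsRing_ball, abs, minus, plus, opp; simpl.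
    rewrite Rabs_pos_eq; lra. }
  assert (Ds : Ico t0 T (t0 + d / 2)) by (split; [lra|exact Hs]).
  specialize (E1 Ds); specialize (E2 Ds). simpl in E1, E2.
  replace (t0 + d / 2 - t0) with (d / 2) in * by ring.
  rewrite (Rabs_pos_eq (d / 2)) in * by lra.
  assert (E : Rabs ((l1 - l2) * (d / 2)) <= Rabs (l1 - l2) / 2 * (d / 2)).
  { replace ((l1 - l2) * (d / 2)) with
      ((y (t0 + d / 2) - y t0 - l2 * (d / 2)) - (y (t0 + d / 2) - y t0 - l1 * (d / 2))) by ring.
    eapply Rle_trans; [apply Rabs_triang|]. rewrite Rabs_Ropp. lra. }
  rewrite Rabs_mult, (Rabs_pos_eq (d / 2)) in E by lra.
  assert (0 < Rabs (l1 - l2)) by (apply Rabs_pos_lt; lra). nra.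
Qed.

(** * Comparison of increments *)

(** The mean value theorem; differentiability is asked in the open interval only. *)
Lemma monotone_of_derive (h dh : R -> R) (s t : R) :
  s <= t -> (forall r, s < r < t -> is_derive h r (dh r)) ->
  (forall r, s <= r <= t -> continuous h r) ->
  (forall r, s <= r <= t -> 0 <= dh r) -> h s <= h t.
Proof.
  intros Hst Hd Hc Hp. destruct (MVT_gen h s t dh) as [c [Hc1 Hc2]].
  - rewrite Rmin_left, Rmax_right by assumption. assumption.
  - rewrite Rmin_left, Rmax_right by assumption. intros r Hr.
    apply continuity_pt_filterlim, Hc, Hr.
  - rewrite Rmin_left, Rmax_right in Hc1 by assumption. specialize (Hp c Hc1). nra.
Qed.

(** Both [phi - h] and [phi + h] are nondecreasing. Comparing with a well-chosen [phi]
    replaces inequalities between integrals. *)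
Lemma derive_domination (h dh phi dphi : R -> R) (s t : R) :
  s <= t -> (forall r, s <= r <= t -> is_derive h r (dh r)) ->
  (forall r, s <= r <= t -> is_derive phi r (dphi r)) ->
  (forall r, s <= r <= t -> Rabs (dh r) <= dphi r) ->
  Rabs (h t - h s) <= phi t - phi s.
Proof.
  intros Hst Hh Hphi Hle.
  assert (H1 : phi s - h s <= phi t - h t).
  { apply (monotone_of_derive (fun r => phi r - h r) (fun r => dphi r - dh r)); auto.
    - intros r Hr. apply (is_derive_minus phi h); [apply Hphi|apply Hh]; lra.
    - intros r Hr. apply (continuous_minus (V := R_NormedModule) phi h); eapply is_derive_R_continuous; eauto.
    - intros r Hr. specialize (Hle r Hr). apply Rabs_le_between in Hle. lra. }
  assert (H2 : phi s + h s <= phi t + h t).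
  { apply (monotone_of_derive (fun r => phi r + h r) (fun r => dphi r + dh r)); auto.
    - intros r Hr. apply (is_derive_plus phi h); [apply Hphi|apply Hh]; lra.
    - intros r Hr. apply (continuous_plus (V := R_NormedModule) phi h); eapply is_derive_R_continuous; eauto.
    - intros r Hr. specialize (Hle r Hr). apply Rabs_le_between in Hle. lra. }
  apply Rabs_le; lra.
Qed.

Lemma eq_of_derive_eq (y z d : R -> R) (t0 t : R) :
  t0 <= t -> (forall s, t0 <= s <= t -> is_derive y s (d s)) ->
  (forall s, t0 <= s <= t -> is_derive z s (d s)) -> y t0 = z t0 -> y t = z t.
Proof.
  intros Ht Hy Hz E.
  assert (H : Rabs ((y t - z t) - (y t0 - z t0)) <= 0 - 0).
  { apply (derive_domination (fun s => y s - z s) (fun s => d s - d s) (fun _ => 0) (fun _ => 0));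
      auto.
    - intros s Hs. apply (is_derive_minus y z); auto.
    - intros s _. apply (is_derive_const 0).
    - intros s _. rewrite Rminus_diag_eq, Rabs_R0; lra. }
  rewrite E, (Rminus_diag_eq (z t0)), Rminus_0_r in H by reflexivity.
  generalize (Rabs_pos (y t - z t)). intros H'.
  assert (Rabs (y t - z t) = 0) by lra. apply Rminus_diag_uniq.
  destruct (Req_dec (y t - z t) 0); [assumption|]. now apply Rabs_no_R0 in H1.
Qed.

(** The mean value theorem applied to [y - z]. As [y] is arbitrary on the left of [t0],
    it is first made constant there by composition with [Rmax t0], which yields a
    function that is continuous at [t0] in the two-sided sense. *)
Lemma primitive_of_derive_within (t0 : R) (T : Rbar) (y z dy dz : R -> R) :
  Rbar_lt t0 T ->
  (forall t, Ico t0 T t -> is_derive_within (Ico t0 T) y t (dy t)) ->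
  (forall t, Ico t0 T t -> is_derive z t (dz t)) ->
  (forall t, Ico t0 T t -> dz t = dy t) ->
  y t0 = z t0 -> forall t, Ico t0 T t -> y t = z t.
Proof.
  intros H0 Hy Hz Heq E0 t Ht.
  assert (Hbt : forall r, t0 <= r <= t -> Ico t0 T r).
  { intros r Hr. apply (Ico_between _ t); auto. apply Ht. }
  destruct (MVT_gen (fun r => y (Rmax t0 r) - z r) t0 t (fun _ => 0)) as [c [_ Hc]].
  - destruct Ht as [Ht Ht']. rewrite Rmin_left, Rmax_right by assumption.
    intros r Hr. replace 0 with (dy r - dz r) by (rewrite Heq; [ring|apply Hbt; lra]).
    apply (is_derive_ext_loc (fun r => y r - z r)).
    + apply (locally_interval _ r t0 p_infty); [easy..|].
      intros q Hq _; simpl in Hq. rewrite Rmax_right by lra. reflexivity.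
    + apply (is_derive_minus y z); [|apply Hz, Hbt; lra].
      apply (is_derive_within_interior (Ico t0 T)); [|apply Hy, Hbt; lra].
      apply (locally_interval _ r t0 T); [easy| |].
      * apply (Hbt r); lra.
      * intros q Hq HqT. split; [apply Rlt_le, Hq|exact HqT].
  - destruct Ht as [Ht Ht']. rewrite Rmin_left, Rmax_right by assumption.
    intros r Hr. apply continuity_pt_filterlim.
    apply (continuous_minus (V := R_NormedModule) (fun r : R => y (Rmax t0 r)) z).
    + apply (continuous_Ico_Rmax y t0 r T); auto.
      * now apply (is_derive_within_continuous_on _ y dy).
      * apply Hbt; lra.
    + apply (ex_derive_continuous z). eexists; apply Hz, Hbt; lra.
  - rewrite (Rmax_right t0 t), (Rmax_right t0 t0) in Hc by (apply Ht || lra). lra.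
Qed.

(** * C2 functions on a half-line *)

(** Two-sided differentiability on a whole left half-line: the working notion that
    replaces one-sided derivatives on [Ico t0 T]. *)
Definition C2_below (T : Rbar) (X P Q : R -> R) : Prop :=
  forall t : R, Rbar_lt t T ->
    is_derive X t (P t) /\ is_derive P t (Q t) /\ continuous Q t.

Definition double_primitive (t0 x0 p0 : R) (q : R -> R) (t : R) : R :=
  x0 + RInt (fun s => p0 + RInt q t0 s) t0 t.

Lemma C2_below_double_primitive (t0 : R) (T : Rbar) (x0 p0 : R) (q : R -> R) :
  Rbar_lt t0 T -> (forall s : R, Rbar_lt s T -> continuous q s) ->
  C2_below T (double_primitive t0 x0 p0 q) (fun t => p0 + RInt q t0 t) q /\
  double_primitive t0 x0 p0 q t0 = x0 /\ p0 + RInt q t0 t0 = p0.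
Proof.
  intros H0 Hq.
  assert (Hprim : forall (c t : R) (r : R -> R),
    (forall s : R, Rbar_lt s T -> continuous r s) -> Rbar_lt t T ->
    is_derive (fun t => c + RInt r t0 t) t (r t)).
  { intros c t r Hr Ht. apply (is_derive_value _ _ (0 + r t)); [|ring].
    apply (is_derive_plus (fun _ => c) (RInt r t0)).
    - apply (is_derive_const c).
    - now apply is_derive_primitive with T. }
  assert (Hpoint : forall (c : R) (r : R -> R), c + RInt r t0 t0 = c).
  { intros c r. rewrite (RInt_point (V := R_CompleteNormedModule)).
    unfold zero; simpl; ring. }
  split; [|split; apply Hpoint].
  intros t Ht. split; [|split; auto].
  apply (Hprim x0 t (fun s => p0 + RInt q t0 s)); auto.
  intros s Hs. eapply is_derive_R_continuous; auto.
Qed.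

(** The second derivative is prolonged by a constant on the left of [t0] and integrated
    twice; on [Ico t0 T] the result has the same data as [x], hence is [x]. *)
Lemma C2_extension_left (t0 : R) (T : Rbar) (x dx ddx : R -> R) :
  Rbar_lt t0 T -> C2_derivatives (Ico t0 T) x dx ddx ->
  exists X P Q, C2_below T X P Q /\
    forall t, Ico t0 T t -> X t = x t /\ P t = dx t /\ Q t = ddx t.
Proof.
  intros H0 [Hx [Hdx Hc]].
  destruct (C2_below_double_primitive t0 T (x t0) (dx t0) (fun t => ddx (Rmax t0 t)))
    as [HC [HX HP]]; auto.
  { intros s Hs. now apply continuous_Ico_Rmax with T. }
  revert HC HX HP. set (X := double_primitive _ _ _ _).
  set (P := fun t => dx t0 + RInt (fun t => ddx (Rmax t0 t)) t0 t). intros HC HX HP.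
  exists X, P, (fun t => ddx (Rmax t0 t)). split; [exact HC|].
  assert (EP : forall t, Ico t0 T t -> dx t = P t).
  { apply (primitive_of_derive_within t0 T dx P ddx (fun t => ddx (Rmax t0 t))); auto.
    - intros t [_ Ht]. now apply HC.
    - intros t [Ht _]. now rewrite Rmax_right. }
  intros t Ht. split; [|split].
  - symmetry. revert t Ht.
    apply (primitive_of_derive_within t0 T x X dx P); auto.
    + intros t [_ Ht]. now apply HC.
    + intros t Ht. now rewrite EP.
  - symmetry; auto.
  - rewrite Rmax_right; auto. apply Ht.
Qed.

(** With [v = x / t] and [u = t x' - x], the equation [x'' = Q] becomes the system
    [v' = u / t ^ 2], [u' = t Q]. *)
Lemma C2_below_radial (T : Rbar) (X P Q : R -> R) (t : R) :
  C2_below T X P Q -> 0 < t -> Rbar_lt t T ->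
  is_derive (fun s => X s / s) t ((t * P t - X t) / t ^ 2) /\
  is_derive (fun s => s * P s - X s) t (t * Q t).
Proof.
  intros H H0 Ht. destruct (H t Ht) as [HX [HP _]]. split.
  - apply (is_derive_value _ _ ((P t * t - X t * 1) / t ^ 2)); [|f_equal; ring].
    apply (is_derive_div X (fun s => s)); auto; [apply (is_derive_id t)|lra].
  - apply (is_derive_value _ _ ((1 * P t + t * Q t) - P t)); [|ring].
    apply (is_derive_minus (fun s => s * P s) X); auto.
    apply (is_derive_mult (fun s : R => s) P); auto; [apply (is_derive_id t)|].
    intros; apply Rmult_comm.
Qed.

(** * Improper integrals *)

Lemma RInt_gen_limit (q A : R -> R) (t0 l : R) :
  is_RInt_gen q (at_point t0) (Rbar_locally p_infty) l ->
  (forall t, t0 <= t -> is_RInt q t0 t (A t)) ->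
  filterlim A (Rbar_locally p_infty) (locally l).
Proof.
  intros Hq HA. apply filterlim_locally. intros eps.
  destruct (proj1 (filterlimi_locally _ _) Hq eps) as [P1 P2 HP1 [M HM] HP].
  exists (Rmax M t0). intros t Ht.
  generalize (Rmax_l M t0) (Rmax_r M t0); intros.
  destruct (HP t0 t) as [z [Hz1 Hz2]].
  - exact HP1.
  - apply HM; lra.
  - simpl in Hz1. rewrite <- (is_RInt_unique _ _ _ _ (HA t ltac:(lra))).
    now rewrite (is_RInt_unique _ _ _ _ Hz1).
Qed.

Lemma nondecreasing_le_limit (A : R -> R) (t0 l : R) :
  filterlim A (Rbar_locally p_infty) (locally l) ->
  (forall s t, t0 <= s <= t -> A s <= A t) -> forall t, t0 <= t -> A t <= l.
Proof.
  intros HA Hm t Ht.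
  apply (filterlim_le (F := Rbar_locally p_infty) (fun _ => A t) A (A t) l).
  - exists t. intros s Hs. apply Hm; lra.
  - apply filterlim_const.
  - exact HA.
Qed.

Lemma is_RInt_of_derive (A q : R -> R) (s t : R) :
  s <= t -> (forall r, s <= r <= t -> is_derive A r (q r)) ->
  (forall r, s <= r <= t -> continuous q r) -> is_RInt q s t (A t - A s).
Proof.
  intros Hst HA Hq. apply (is_RInt_derive (V := R_CompleteNormedModule) A q);
    rewrite Rmin_left, Rmax_right; auto.
Qed.

(** [q] is meant for arguments [>= t0] only; freezing it at [q t0] on the left of [t0] makes
    its primitive differentiable at [t0] itself. *)
Lemma primitive_Ici (t0 : R) (q : R -> R) :
  (forall t, continuous (fun s => q (Rmax t0 s)) t) ->
  exists A : R -> R, A t0 = 0 /\ (forall t, t0 <= t -> is_derive A t (q t)) /\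
    (forall t, t0 <= t -> is_RInt q t0 t (A t)).
Proof.
  intros Hq. set (qq := fun s => q (Rmax t0 s)).
  assert (D : forall t, is_derive (RInt qq t0) t (qq t)).
  { intros t. now apply is_derive_primitive with p_infty. }
  exists (RInt qq t0). split; [|split].
  - apply (RInt_point (V := R_CompleteNormedModule)).
  - intros t Ht. replace (q t) with (qq t); auto. unfold qq. now rewrite Rmax_right.
  - intros t Ht. apply (is_RInt_ext qq).
    + rewrite Rmin_left by assumption. intros s Hs. unfold qq. rewrite Rmax_right; lra.
    + replace (RInt qq t0 t) with (RInt qq t0 t - RInt qq t0 t0).
      * apply is_RInt_of_derive; auto.
      * rewrite (RInt_point (V := R_CompleteNormedModule)). unfold zero; simpl; ring.
Qed.

(** The clock [A] that controls [u], as the derivative of [u] is at most a constant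
    times [t * a t] once [v] is bounded. *)
Lemma weight_primitive (t0 K : R) (a : R -> R) :
  1 <= t0 -> (forall t, t0 <= t -> 0 <= a t) ->
  continuous_on (fun t : R => t0 <= t) a ->
  is_RInt_gen (fun t => t * a t) (at_point t0) (Rbar_locally p_infty) K ->
  exists A : R -> R, A t0 = 0 /\
    (forall t, t0 <= t -> is_derive A t (t * a t)) /\
    filterlim A (Rbar_locally p_infty) (locally K) /\
    forall t, t0 <= t -> A t <= K.
Proof.
  intros ht0 a_ge0 a_cont hK.
  destruct (primitive_Ici t0 (fun t => t * a t)) as [B [B0 [HB HI]]].
  { intros t. apply (continuous_mult (Rmax t0) (fun s => a (Rmax t0 s))).
    - apply continuous_Rmax_l.
    - apply (continuous_on_comp (fun t => t0 <= t) a (Rmax t0)); auto.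
      + apply continuous_Rmax_l.
      + apply Rmax_l.
      + apply filter_forall. intros s; apply Rmax_l. }
  assert (HL : filterlim B (Rbar_locally p_infty) (locally K))
    by now apply RInt_gen_limit with (fun t => t * a t) t0.
  exists B. split; [exact B0|split; [exact HB|split; [exact HL|]]].
  apply nondecreasing_le_limit; auto.
  intros s t [Hs Hst]. apply (monotone_of_derive B (fun r => r * a r)); auto.
  - intros r Hr. apply HB; lra.
  - intros r Hr. eapply is_derive_R_continuous, HB; lra.
  - intros r Hr. apply Rmult_le_pos; [lra|apply a_ge0; lra].
Qed.

(** [G] is the primitive of [1 / g] in the separable equation [w' = C g(w) / t ^ 2].
    As [G] tends to the integral over the half-line from [w0], any bound
    [I] below that integral is exceeded at some finite height [W]. *)
Lemma escape_level (g : R -> R) (w0 I : R) :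
  1 <= w0 ->
  continuous_on (fun s : R => 0 <= s) g -> (forall s, 0 < s -> 0 < g s) ->
  ex_RInt_gen (fun s => 1 / g s) (at_point 1) (Rbar_locally p_infty) ->
  I < RInt_gen (fun s => 1 / g s) (at_point w0) (Rbar_locally p_infty) ->
  exists (G : R -> R) (W : R), G w0 = 0 /\ w0 <= W /\ I < G W /\
    forall y, w0 <= y -> is_derive G y (1 / g y).
Proof.
  intros Hw Hc Hpos Hex HI.
  assert (Hinv : forall b t : R, 1 <= b -> continuous (fun s => 1 / g (Rmax b s)) t).
  { intros b t Hb. apply (continuous_scal_r 1 (fun s => / g (Rmax b s))).
    assert (Hr : forall s, 1 <= Rmax b s) by (intros s; generalize (Rmax_l b s); lra).
    apply (continuous_comp (fun s => g (Rmax b s)) Rinv).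
    - apply (continuous_on_comp (fun s => 0 <= s) g (Rmax b)); auto.
      + apply continuous_Rmax_l.
      + specialize (Hr t); lra.
      + apply filter_forall; intros s; specialize (Hr s); lra.
    - apply continuous_Rinv, Rgt_not_eq, Hpos. specialize (Hr t); lra. }
  destruct (primitive_Ici w0 (fun s => 1 / g s) (fun t => Hinv w0 t Hw))
    as [G [G0 [HG HGI]]].
  destruct (primitive_Ici 1 (fun s => 1 / g s) (fun t => Hinv 1 t (Rle_refl 1)))
    as [G1 [_ [_ HG1I]]].
  assert (Hex' : ex_RInt_gen (fun s => 1 / g s) (at_point w0) (Rbar_locally p_infty)).
  { destruct Hex as [l Hl]. exists (plus (opp (G1 w0)) l).
    apply (is_RInt_gen_Chasles (V := R_NormedModule) _ 1 (opp (G1 w0)) l); [|exact Hl].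
    apply is_RInt_gen_at_point. apply (is_RInt_swap (V := R_CompleteNormedModule)).
    now apply HG1I. }
  apply (RInt_gen_correct (V := R_CompleteNormedModule)) in Hex'.
  assert (HL := RInt_gen_limit _ _ _ _ Hex' HGI).
  revert HI HL. generalize (RInt_gen (fun s => 1 / g s) (at_point w0) (Rbar_locally p_infty)).
  intros J HI HL. simpl in J.
  assert (He : 0 < J - I) by lra.
  destruct (proj1 (filterlim_locally _ _) HL (mkposreal _ He)) as [M HM].
  exists G, (Rmax w0 (M + 1)). split; [exact G0|split; [apply Rmax_l|split; [|exact HG]]].
  - specialize (HM (Rmax w0 (M + 1))). generalize (Rmax_r w0 (M + 1)); intros.
    specialize (HM ltac:(lra)). apply Rabs_lt_between in HM. simpl in HM.
    unfold minus, plus, opp in HM; simpl in HM. lra.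
Qed.

(** * The a priori bound *)

(** Bihari's argument. Let [w] be [1 + |v(t0)|] plus the integral of [|u| / s ^ 2], so that
    [w] is nondecreasing and dominates both [1] and [|v|]. Comparison with
    [g(w(t)) A] between [t0] and [t] gives [|u(t)| <= |u(t0)| + K g(w(t)) <= C g(w(t))], where
    [|u(t0)| <= 1 + u(t0) ^ 2 / 2] and [g 1 <= g(w(t))] absorb the initial value. Hence
    [w' <= C g(w) / t ^ 2], so [G(w(t)) <= C / t0 - C / t <= C / t0 < G(W)] and [w] never exceeds
    the height [W]. The bounds do not depend on [T]. *)
Lemma a_priori_bound (t0 : R) (T : Rbar) (a g : R -> R) (K : R) (X P Q : R -> R) :
  1 <= t0 -> Rbar_lt t0 T ->
  (forall t, t0 <= t -> 0 <= a t) ->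
  continuous_on (fun t : R => t0 <= t) a ->
  continuous_on (fun s : R => 0 <= s) g ->
  (forall s, 0 < s -> 0 < g s) ->
  (forall r s, 0 <= r -> r <= s -> g r <= g s) ->
  is_RInt_gen (fun t => t * a t) (at_point t0) (Rbar_locally p_infty) K ->
  ex_RInt_gen (fun s => 1 / g s) (at_point 1) (Rbar_locally p_infty) ->
  C2_below T X P Q ->
  (forall t, Ico t0 T t -> Rabs (Q t) <= a t * g (Rabs (X t / t))) ->
  / t0 * (K + (1 + (t0 * P t0 - X t0) ^ 2 / 2) / g 1)
    < RInt_gen (fun s => 1 / g s) (at_point (1 + Rabs (X t0 / t0)))
        (Rbar_locally p_infty) ->
  exists W M, forall t, Ico t0 T t ->
    Rabs (X t / t) <= W /\ Rabs (t * P t - X t) <= M.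
Proof.
  intros ht0 H0 a_ge0 a_cont g_cont g_gt0 g_mono hK hg HC HQ.
  set (u := fun t => t * P t - X t). set (v := fun t => X t / t).
  change (t0 * P t0 - X t0) with (u t0). change (X t0 / t0) with (v t0).
  set (w0 := 1 + Rabs (v t0)). set (C := K + (1 + u t0 ^ 2 / 2) / g 1).
  intros Hlt.
  assert (Hw0 : 1 <= w0) by (unfold w0; generalize (Rabs_pos (v t0)); lra).
  destruct (escape_level g w0 _ Hw0 g_cont g_gt0 hg Hlt) as [G [W [G0 [HwW [HW HG]]]]].
  destruct (weight_primitive t0 K a ht0 a_ge0 a_cont hK) as [A [A0 [HA [HAlim HAK]]]].
  assert (HT : forall t : R, Ico t0 T t -> 0 < t /\ Rbar_lt t T)
    by (intros t [Ht Ht']; split; [lra|exact Ht']).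
  assert (Hv : forall t, Ico t0 T t -> is_derive v t (u t / t ^ 2)).
  { intros t Ht. destruct (HT t Ht). now apply (C2_below_radial T X P Q). }
  assert (Hu : forall t, Ico t0 T t -> is_derive u t (t * Q t)).
  { intros t Ht. destruct (HT t Ht). now apply (C2_below_radial T X P Q). }
  set (q := fun s => Rabs (u (Rmax t0 s)) / Rmax t0 s ^ 2).
  assert (Hq : forall s : R, Rbar_lt s T -> continuous q s).
  { intros s Hs.
    assert (Hs' : Ico t0 T (Rmax t0 s)) by (split; [apply Rmax_l|now apply Rbar_lt_Rmax]).
    apply (continuous_comp (Rmax t0) (fun r => Rabs (u r) / r ^ 2)); [apply continuous_Rmax_l|].
    apply (continuous_mult (fun r => Rabs (u r)) (fun r => / r ^ 2)).
    - apply continuous_Rabs_comp. eapply is_derive_R_continuous, Hu, Hs'.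
    - destruct (HT _ Hs'). apply (ex_derive_continuous (fun r => / r ^ 2)).
      auto_derive. apply Rgt_not_eq; nra. }
  set (w := fun t => w0 + RInt q t0 t).
  assert (w_t0 : w t0 = w0).
  { unfold w. rewrite (RInt_point (V := R_CompleteNormedModule)). unfold zero; simpl; ring. }
  assert (Hw : forall t, Ico t0 T t -> is_derive w t (Rabs (u t) / t ^ 2)).
  { intros t [Ht HtT].
    apply (is_derive_value _ _ (0 + q t)); [|unfold q; rewrite Rmax_right by assumption; ring].
    apply (is_derive_plus (fun _ => w0) (RInt q t0)); [apply (is_derive_const w0)|].
    now apply is_derive_primitive with T. }
  assert (Hsub : forall t r : R, Ico t0 T t -> t0 <= r <= t -> Ico t0 T r).
  { intros t r [_ Ht] Hr. now apply Ico_between with t. }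
  assert (dw_ge0 : forall t, Ico t0 T t -> 0 <= Rabs (u t) / t ^ 2).
  { intros t Ht. destruct (HT t Ht). apply Rle_div_r; [nra|].
    rewrite Rmult_0_l. apply Rabs_pos. }
  assert (w_mono : forall s t, Ico t0 T t -> t0 <= s <= t -> w s <= w t).
  { intros s t Ht Hs. apply (monotone_of_derive w (fun r => Rabs (u r) / r ^ 2)).
    - apply Hs.
    - intros r Hr. apply Hw, (Hsub t); auto; lra.
    - intros r Hr. eapply is_derive_R_continuous, Hw, (Hsub t); auto; lra.
    - intros r Hr. apply dw_ge0, (Hsub t); auto; lra. }
  assert (w_ge : forall t, Ico t0 T t -> w0 <= w t).
  { intros t Ht. rewrite <- w_t0. apply w_mono; auto. destruct Ht; lra. }
  assert (v_le_w : forall t, Ico t0 T t -> Rabs (v t) <= w t).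
  { intros t Ht.
    assert (E : Rabs (v t - v t0) <= w t - w t0).
    { apply (derive_domination v (fun r => u r / r ^ 2) w (fun r => Rabs (u r) / r ^ 2)).
      - apply Ht.
      - intros r Hr; apply Hv, (Hsub t); auto.
      - intros r Hr; apply Hw, (Hsub t); auto.
      - intros r Hr. unfold Rdiv at 1. rewrite Rabs_mult, (Rabs_pos_eq (/ r ^ 2)).
        + apply Rle_refl.
        + apply Rlt_le, Rinv_0_lt_compat. nra. }
    replace (v t) with (v t0 + (v t - v t0)) by ring.
    eapply Rle_trans; [apply Rabs_triang|]. rewrite w_t0 in E. unfold w0 in E. lra. }
  assert (g_w_pos : forall t, Ico t0 T t -> g 1 <= g (w t) /\ 0 < g 1).
  { intros t Ht. split; [apply g_mono|apply g_gt0]; try lra. specialize (w_ge t Ht); lra. }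
  assert (u_le : forall t, Ico t0 T t -> Rabs (u t) <= C * g (w t)).
  { intros t Ht. destruct (g_w_pos t Ht) as [g1 g2].
    assert (E : Rabs (u t - u t0) <= g (w t) * A t - g (w t) * A t0).
    { apply (derive_domination u (fun r => r * Q r) (fun r => g (w t) * A r)
        (fun r => g (w t) * (r * a r))).
      - apply Ht.
      - intros r Hr; apply Hu, (Hsub t); auto.
      - intros r Hr. apply (is_derive_scal A). apply HA, Hr.
      - intros r Hr. rewrite Rabs_mult, (Rabs_pos_eq r) by lra.
        assert (Hr' := Hsub t r Ht Hr).
        specialize (HQ r Hr').
        assert (a r * g (Rabs (X r / r)) <= a r * g (w t)).
        { apply Rmult_le_compat_l; [apply a_ge0, Hr|]. apply g_mono; [apply Rabs_pos|].
          apply Rle_trans with (w r); [now apply v_le_w|now apply w_mono]. }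
        nra. }
    assert (HAt := HAK t (proj1 Ht)). rewrite A0 in E.
    assert (E1 : Rabs (u t) <= Rabs (u t0) + g (w t) * K).
    { replace (u t) with (u t0 + (u t - u t0)) by ring.
      eapply Rle_trans; [apply Rabs_triang|]. nra. }
    (* 1 + r ^ 2 / 2 - r = ((r - 1) ^ 2 + 1) / 2 *)
    assert (E2 : Rabs (u t0) <= 1 + u t0 ^ 2 / 2).
    { rewrite <- (pow2_abs (u t0)). generalize (pow2_ge_0 (Rabs (u t0) - 1)). lra. }
    assert (E3 : 1 + u t0 ^ 2 / 2 <= (1 + u t0 ^ 2 / 2) / g 1 * g (w t)).
    { apply Rle_trans with ((1 + u t0 ^ 2 / 2) / g 1 * g 1).
      - right; field; lra.
      - apply Rmult_le_compat_l; [|exact g1]. apply Rlt_le, Rdiv_lt_0_compat; [nra|lra]. }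
    unfold C. nra. }
  assert (w_le : forall t, Ico t0 T t -> w t <= W).
  { intros t Ht. destruct (HT t Ht) as [tpos _].
    assert (Cpos : 0 <= C).
    { destruct (g_w_pos t Ht). specialize (u_le t Ht). generalize (Rabs_pos (u t)). nra. }
    (* C / t0 - C / r is the integral of the bound C / s ^ 2 on (G o w)' *)
    set (H := fun r => - (C / r) - G (w r)).
    assert (E : H t0 <= H t).
    { apply (monotone_of_derive H (fun r => C / r ^ 2 - Rabs (u r) / r ^ 2 * (1 / g (w r)))).
      - apply Ht.
      - intros r Hr. assert (Hr' : Ico t0 T r) by (apply (Hsub t); auto; lra).
        apply (is_derive_minus (fun r => - (C / r)) (fun r => G (w r))).
        + auto_derive; [lra|field; lra].
        + apply (is_derive_comp G w); [apply HG, w_ge, Hr'|apply Hw, Hr'].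
      - intros r Hr. assert (Hr' : Ico t0 T r) by (apply (Hsub t); auto; lra).
        apply (is_derive_R_continuous H r (C / r ^ 2 - Rabs (u r) / r ^ 2 * (1 / g (w r)))).
        apply (is_derive_minus (fun r => - (C / r)) (fun r => G (w r))).
        + auto_derive; [lra|field; lra].
        + apply (is_derive_comp G w); [apply HG, w_ge, Hr'|apply Hw, Hr'].
      - intros r Hr. assert (Hr' : Ico t0 T r) by (apply (Hsub t); auto; lra).
        destruct (g_w_pos r Hr') as [g1 g2]. specialize (u_le r Hr').
        replace (C / r ^ 2 - Rabs (u r) / r ^ 2 * (1 / g (w r)))
          with ((C * g (w r) - Rabs (u r)) / (r ^ 2 * g (w r))) by (field; lra).
        apply Rdiv_le_0_compat; [lra|]. apply Rmult_lt_0_compat; [nra|lra]. }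
    unfold H in E. rewrite w_t0, G0 in E.
    assert (0 <= C / t) by (apply Rdiv_le_0_compat; lra).
    destruct (Rle_lt_dec (w t) W) as [|Hlt']; [assumption|exfalso].
    assert (G W <= G (w t)).
    { apply (monotone_of_derive G (fun r => 1 / g r)).
      - lra.
      - intros r Hr; apply HG; lra.
      - intros r Hr; eapply is_derive_R_continuous, HG; lra.
      - intros r Hr. apply Rlt_le, Rdiv_lt_0_compat; [lra|apply g_gt0; lra]. }
    unfold Rdiv in *. lra. }
  exists W, (C * g W).
  intros t Ht. split.
  - eapply Rle_trans; [apply v_le_w|apply w_le]; auto.
  - eapply Rle_trans; [apply u_le, Ht|]. destruct (g_w_pos t Ht).
    assert (g (w t) <= g W) by (apply g_mono; [specialize (w_ge t Ht); lra|now apply w_le]).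
    specialize (u_le t Ht). generalize (Rabs_pos (u t)). intros.
    assert (0 <= C) by nra. apply Rmult_le_compat_l; lra.
Qed.

(** * Behaviour at infinity *)

(** A function with increments dominated by those of a convergent [phi] is Cauchy. It is
    used at [+oo] and at a finite [T] from the left. *)
Lemma cauchy_of_domination (F : (R -> Prop) -> Prop) (D : R -> Prop)
  (h phi : R -> R) (l : R) :
  ProperFilter F -> F D ->
  (forall s t, D s -> D t -> s <= t -> Rabs (h t - h s) <= phi t - phi s) ->
  filterlim phi F (locally l) -> exists m : R, filterlim h F (locally m).
Proof.
  intros HF HD Hdom Hphi.
  apply (filterlim_locally_cauchy (U := R_CompleteSpace)). intros eps.
  exists (fun t => D t /\ ball l (pos_div_2 eps) (phi t)). split.
  - apply filter_and; [exact HD|]. exact (proj1 (filterlim_locally _ _) Hphi (pos_div_2 eps)).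
  - assert (W : forall s t, s <= t -> D s /\ ball l (pos_div_2 eps) (phi s) ->
      D t /\ ball l (pos_div_2 eps) (phi t) -> Rabs (h t - h s) < eps).
    { intros s t Hst [Ds Bs] [Dt Bt].
      eapply Rle_lt_trans; [now apply Hdom|].
      apply Rabs_lt_between in Bs. apply Rabs_lt_between in Bt.
      unfold minus, plus, opp in Bs, Bt; simpl in Bs, Bt. lra. }
    intros s t Hs Ht. change (Rabs (h t - h s) < eps).
    destruct (Rle_lt_dec s t).
    + now apply W.
    + rewrite Rabs_minus_sym. apply W; auto; lra.
Qed.

Lemma lim_opp_div_pinfty (M : R) :
  filterlim (fun t => - (M / t)) (Rbar_locally p_infty) (locally 0).
Proof.
  replace 0 with (- M * 0) by ring.
  apply (filterlim_ext (fun t => - M * / t)); [intros t; unfold Rdiv; ring|].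
  apply (filterlim_comp _ _ _ Rinv (fun y => - M * y) _ (locally 0)).
  - apply (is_lim_inv (fun t => t) p_infty p_infty); [apply is_lim_id|easy].
  - apply (continuous_scal_r (- M) (fun y : R => y) 0), continuous_id.
Qed.

(** [v] converges because its increments are dominated by those of [- M / t], and [u]
    because its increments are dominated by those of [g W * A]. Let [v1], [u1] be the limits.
    If [v1 = 0], then [X = t v = o(t)]. Otherwise [r = v + u1 / t] also tends to [v1], and
    [r' = (u - u1) / t ^ 2] is eventually below [eps / t ^ 2] in absolute value; integrating
    from [t] to [+oo] gives [|v1 - r| <= eps / t], that is [|X - v1 t + u1| <= eps]. *)
Lemma asymptotics (t0 K W M : R) (a g X P Q : R -> R) :
  1 <= t0 ->
  (forall t, t0 <= t -> 0 <= a t) ->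
  continuous_on (fun t : R => t0 <= t) a ->
  (forall r s, 0 <= r -> r <= s -> g r <= g s) ->
  is_RInt_gen (fun t => t * a t) (at_point t0) (Rbar_locally p_infty) K ->
  C2_below p_infty X P Q ->
  (forall t, t0 <= t -> Rabs (Q t) <= a t * g (Rabs (X t / t))) ->
  (forall t, t0 <= t -> Rabs (X t / t) <= W /\ Rabs (t * P t - X t) <= M) ->
  little_o_pinfty X (fun t => t) \/
  exists x1 x2 : R, x1 <> 0 /\
     little_o_pinfty (fun t => X t - (x1 * t + x2)) (fun _ => 1).
Proof.
  intros ht0 a_ge0 a_cont g_mono hK HC HQ Hb.
  set (u := fun t => t * P t - X t). set (v := fun t => X t / t).
  destruct (weight_primitive t0 K a ht0 a_ge0 a_cont hK) as [A [A0 [HA [HAlim _]]]].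
  assert (Hv : forall t, t0 <= t -> is_derive v t (u t / t ^ 2)).
  { intros t Ht. apply (C2_below_radial p_infty X P Q); auto; [lra|exact I]. }
  assert (Hu : forall t, t0 <= t -> is_derive u t (t * Q t)).
  { intros t Ht. apply (C2_below_radial p_infty X P Q); auto; [lra|exact I]. }
  assert (dinv : forall (N t : R), t0 <= t -> is_derive (fun r => - (N / r)) t (N / t ^ 2)).
  { intros N t Ht. auto_derive; [lra|field; lra]. }
  assert (Heq : forall (N y t : R), t0 <= t -> Rabs y <= N -> Rabs (y / t ^ 2) <= N / t ^ 2).
  { intros N y t Ht Hy. unfold Rdiv. rewrite Rabs_mult.
    assert (0 < / t ^ 2) by (apply Rinv_0_lt_compat; nra).
    rewrite (Rabs_pos_eq (/ t ^ 2)) by lra. apply Rmult_le_compat_r; lra. }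
  assert (Hnear : Rbar_locally p_infty (fun t => t0 <= t)) by (exists t0; intros; lra).
  destruct (cauchy_of_domination (Rbar_locally p_infty) (fun t => t0 <= t) v
    (fun t => - (M / t)) 0) as [v1 Hv1]; auto using Rbar_locally_filter.
  { intros s t Hs Ht Hst.
    apply (derive_domination v (fun r => u r / r ^ 2) (fun t => - (M / t)) (fun r => M / r ^ 2));
      auto; intros r Hr.
    - apply Hv; lra.
    - apply dinv; lra.
    - apply Heq; [lra|]. apply Hb; lra. }
  { apply lim_opp_div_pinfty. }
  destruct (cauchy_of_domination (Rbar_locally p_infty) (fun t => t0 <= t) u
    (fun t => g W * A t) (g W * K)) as [u1 Hu1]; auto using Rbar_locally_filter.
  { intros s t Hs Ht Hst.
    apply (derive_domination u (fun r => r * Q r) (fun t => g W * A t) (fun r => g W * (r * a r)));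
      auto; intros r Hr.
    - apply Hu; lra.
    - apply (is_derive_scal A), HA; lra.
    - rewrite Rabs_mult, (Rabs_pos_eq r) by lra.
      assert (a r * g (Rabs (X r / r)) <= a r * g W).
      { apply Rmult_le_compat_l; [apply a_ge0; lra|]. apply g_mono; [apply Rabs_pos|].
        apply Hb; lra. }
      specialize (HQ r ltac:(lra)). nra. }
  { apply (filterlim_comp _ _ _ A (fun y => g W * y) _ (locally K)); auto.
    apply (continuous_scal_r (g W) (fun y : R => y) K), continuous_id. }
  destruct (Req_dec v1 0) as [Hz|Hnz]; [left|right].
  - intros eps. rewrite Hz in Hv1.
    generalize (filter_and _ _ Hnear (proj1 (filterlim_locally _ _) Hv1 eps)).
    apply filter_imp. intros t [Ht Hball].
    change (Rabs (X t) <= eps * Rabs t).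
    change (Rabs (v t - 0) < eps) in Hball. rewrite Rminus_0_r in Hball.
    replace (X t) with (v t * t) by (unfold v; field; lra).
    rewrite Rabs_mult. apply Rmult_le_compat_r; [apply Rabs_pos|lra].
  - exists v1, (- u1). split; [exact Hnz|]. intros eps.
    destruct (filter_and _ _ Hnear (proj1 (filterlim_locally _ _) Hu1 eps)) as [N HN].
    exists N. intros t Ht. destruct (HN t Ht) as [Htt0 _].
    change (Rabs (X t - (v1 * t + - u1)) <= eps * Rabs 1). rewrite Rabs_R1, Rmult_1_r.
    set (r := fun s => v s + u1 / s).
    assert (Hr : filterlim r (Rbar_locally p_infty) (locally v1)).
    { replace v1 with (v1 + 0) by ring.
      apply (filterlim_comp_2 (G := locally v1) (H := locally 0) v (fun s => u1 / s) Rplus); auto.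
      - apply (filterlim_ext (fun s => - (- u1 / s))); [intros s; unfold Rdiv; ring|].
        apply lim_opp_div_pinfty.
      - apply (filterlim_plus v1 0). }
    assert (E : Rabs (v1 - r t) <= eps / t).
    { assert (Hdom : forall s, t <= s -> Rabs (r s - r t) <= eps / t).
      { intros s Hs.
        apply Rle_trans with (- (eps / s) - - (eps / t)).
        - apply (derive_domination r (fun q => (u q - u1) / q ^ 2)
            (fun q => - (eps / q)) (fun q => eps / q ^ 2)); auto; intros q Hq.
          + apply (is_derive_value _ _ (u q / q ^ 2 + - u1 / q ^ 2)).
            * apply (is_derive_plus v (fun s => u1 / s)); [apply Hv; lra|].
              auto_derive; [lra|field; lra].
            * field; lra.
          + apply dinv; lra.
          + apply Heq; [lra|]. apply Rlt_le. apply (HN q). lra.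
        - assert (0 < eps / s) by (apply Rdiv_lt_0_compat; [apply cond_pos|lra]). lra. }
      apply Rabs_le. split.
      - assert (Hle : r t - eps / t <= v1); [|lra].
        apply (filterlim_le (F := Rbar_locally p_infty) (fun _ => r t - eps / t) r
          (r t - eps / t) v1); [|apply filterlim_const|exact Hr].
        exists t. intros s Hs. specialize (Hdom s ltac:(lra)).
        apply Rabs_le_between in Hdom. lra.
      - assert (Hle : v1 <= r t + eps / t); [|lra].
        apply (filterlim_le (F := Rbar_locally p_infty) r (fun _ => r t + eps / t)
          v1 (r t + eps / t)); [|exact Hr|apply filterlim_const].
        exists t. intros s Hs. specialize (Hdom s ltac:(lra)).
        apply Rabs_le_between in Hdom. lra. }
    replace (X t - (v1 * t + - u1)) with (- (t * (v1 - r t))) by (unfold r, v; field; lra).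
    rewrite Rabs_Ropp, Rabs_mult, (Rabs_pos_eq t) by lra.
    replace (pos eps) with (t * (eps / t)) by (field; lra).
    apply Rmult_le_compat_l; lra.
Qed.

(** * Local existence *)

(** The Banach fixed point theorem for the sup norm on continuous functions, with
    ratio [1/2]. Only [Phi z0 - z0] has to be bounded, so the functions themselves may be
    unbounded. *)
Lemma contraction_fixed_point (Phi : (R -> R) -> R -> R) (z0 : R -> R) (D : R) :
  (forall z : R -> R, (forall t, continuous z t) -> forall t, continuous (Phi z) t) ->
  (forall (y z : R -> R) (e : R), (forall t, continuous y t) -> (forall t, continuous z t) ->
     (forall t, Rabs (y t - z t) <= e) -> forall t, Rabs (Phi y t - Phi z t) <= e / 2) ->
  (forall t, continuous z0 t) -> (forall t, Rabs (Phi z0 t - z0 t) <= D) ->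
  exists z : R -> R, (forall t, continuous z t) /\ forall t, Phi z t = z t.
Proof.
  intros Hcont Hcontr Hz0 HD.
  set (zn := fun n => Nat.iter n Phi z0).
  assert (cn : forall n t, continuous (zn n) t).
  { induction n; [exact Hz0|]. intros t. now apply Hcont. }
  assert (D0 : 0 <= D) by (eapply Rle_trans; [apply Rabs_pos|apply (HD 0)]).
  assert (step : forall n t, Rabs (zn (S n) t - zn n t) <= D * (/ 2) ^ n).
  { induction n; intros t.
    - rewrite pow_O, Rmult_1_r. apply HD.
    - replace (D * (/ 2) ^ S n) with (D * (/ 2) ^ n / 2) by (simpl; field).
      apply (Hcontr (zn (S n)) (zn n)); auto. }
  assert (tail : forall n k t, Rabs (zn (n + k)%nat t - zn n t) <= 2 * D * (/ 2) ^ n).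
  { intros n k t.
    apply Rle_trans with (2 * D * ((/ 2) ^ n - (/ 2) ^ (n + k))).
    - induction k.
      + rewrite Nat.add_0_r, !Rminus_diag_eq, Rabs_R0 by reflexivity. lra.
      + rewrite Nat.add_succ_r. specialize (step (n + k)%nat t).
        replace (zn (S (n + k)) t - zn n t)
          with ((zn (S (n + k)) t - zn (n + k)%nat t) + (zn (n + k)%nat t - zn n t)) by ring.
        eapply Rle_trans; [apply Rabs_triang|]. simpl pow. lra.
    - assert (0 <= (/ 2) ^ (n + k)) by (apply pow_le; lra). nra. }
  assert (Hlim : filterlim (fun n => 4 * D * (/ 2) ^ n) eventually (locally 0)).
  { replace 0 with (4 * D * 0) by ring.
    apply (is_lim_seq_scal_l (fun n => (/ 2) ^ n) (4 * D) 0), is_lim_seq_geom.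
    rewrite Rabs_pos_eq; lra. }
  destruct (proj1 (filterlim_locally_cauchy (U := @fct_CompleteSpace R R_CompleteSpace)
    (F := eventually) zn)) as [z Hz].
  { intros eps.
    destruct (proj1 (filterlim_locally _ _) Hlim eps) as [N HN].
    specialize (HN N (le_n N)). apply Rabs_lt_between in HN.
    unfold minus, plus, opp in HN; simpl in HN.
    exists (fun n => (N <= n)%nat). split; [now exists N|].
    intros m n Hm Hn t. change (Rabs (zn n t - zn m t) < eps).
    assert (Em := tail N (m - N)%nat t). assert (En := tail N (n - N)%nat t).
    replace (N + (m - N))%nat with m in Em by lia.
    replace (N + (n - N))%nat with n in En by lia.
    apply Rabs_le_between in Em. apply Rabs_le_between in En.
    apply Rabs_lt_between. lra. }
  assert (Hunif : forall e, 0 < e -> exists N, forall n, (N <= n)%nat ->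
    forall t, Rabs (zn n t - z t) < e).
  { intros e He. destruct (proj1 (filterlim_locally _ _) Hz (mkposreal e He)) as [N HN].
    exists N. intros n Hn t. exact (HN n Hn t). }
  (* a uniform limit of continuous functions is continuous: the 3-epsilon argument *)
  assert (cz : forall t, continuous z t).
  { intros t. apply filterlim_locally. intros eps. destruct eps as [e He].
    destruct (Hunif (e / 3) ltac:(lra)) as [N HN]. specialize (HN N (le_n N)).
    assert (He3 : 0 < e / 3) by lra.
    generalize (proj1 (filterlim_locally _ _) (cn N t) (mkposreal _ He3)).
    apply filter_imp. intros s Hs.
    change (Rabs (zn N s - zn N t) < e / 3) in Hs. change (Rabs (z s - z t) < e).
    generalize (HN s) (HN t). intros H1 H2.
    apply Rabs_lt_between in Hs. apply Rabs_lt_between in H1. apply Rabs_lt_between in H2.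
    apply Rabs_lt_between. lra. }
  exists z. split; [exact cz|]. intros t.
  apply Rminus_diag_uniq. destruct (Req_dec (Phi z t - z t) 0) as [|Hne]; [assumption|exfalso].
  apply Rabs_pos_lt in Hne. set (e := Rabs (Phi z t - z t)) in *.
  destruct (Hunif (e / 2) ltac:(lra)) as [N HN].
  assert (H1 := Hcontr (zn N) z (e / 2) (cn N) cz (fun t => Rlt_le _ _ (HN N (le_n N) t)) t).
  assert (H2 := HN (S N) ltac:(lia) t).
  change (Phi (zn N) t) with (zn (S N) t) in H1.
  assert (H3 : e <= Rabs (zn (S N) t - Phi z t) + Rabs (zn (S N) t - z t)).
  { unfold e. replace (Phi z t - z t) with (- (zn (S N) t - Phi z t) + (zn (S N) t - z t)) by ring.
    eapply Rle_trans; [apply Rabs_triang|]. rewrite Rabs_Ropp. apply Rle_refl. }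
  lra.
Qed.

(** One factor [d] for each of the two integrations. *)
Lemma double_primitive_contraction (T d x0 p0 e : R) (q1 q2 : R -> R) :
  (forall t, continuous q1 t) -> (forall t, continuous q2 t) ->
  (forall t, Rabs (q1 t - q2 t) <= e) ->
  forall t, T <= t <= T + d ->
  Rabs (double_primitive T x0 p0 q1 t - double_primitive T x0 p0 q2 t) <= e * d * d.
Proof.
  intros H1 H2 He t Ht.
  destruct (C2_below_double_primitive T p_infty x0 p0 q1 I (fun t _ => H1 t)) as [C1 [X1 P1]].
  destruct (C2_below_double_primitive T p_infty x0 p0 q2 I (fun t _ => H2 t)) as [C2 [X2 P2]].
  assert (e0 : 0 <= e) by (eapply Rle_trans; [apply Rabs_pos|apply (He 0)]).
  assert (dl : forall c r : R, is_derive (fun r => c * r) r c).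
  { intros c r. auto_derive; [exact I|ring]. }
  set (X := double_primitive T x0 p0 q1) in *. set (Y := double_primitive T x0 p0 q2) in *.
  set (P := fun t => p0 + RInt q1 T t) in *. set (S := fun t => p0 + RInt q2 T t) in *.
  assert (E1 : forall r, T <= r <= T + d -> Rabs (P r - S r) <= e * d).
  { intros r Hr.
    assert (E : Rabs ((P r - S r) - (P T - S T)) <= e * r - e * T).
    { apply (derive_domination (fun r => P r - S r) (fun r => q1 r - q2 r)
        (fun r => e * r) (fun _ => e)); auto; [lra|]. intros s Hs.
      apply (is_derive_minus P S); [now apply C1|now apply C2]. }
    change (P T) with (p0 + RInt q1 T T) in E. change (S T) with (p0 + RInt q2 T T) in E.
    rewrite P1, P2 in E. replace (P r - S r - (p0 - p0)) with (P r - S r) in E by ring. nra. }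
  assert (E : Rabs ((X t - Y t) - (X T - Y T)) <= e * d * t - e * d * T).
  { apply (derive_domination (fun r => X r - Y r) (fun r => P r - S r)
      (fun r => e * d * r) (fun _ => e * d)); auto; [lra| |].
    - intros s Hs. apply (is_derive_minus X Y); [now apply C1|now apply C2].
    - intros s Hs. apply E1. lra. }
  rewrite X1, X2 in E. replace (X t - Y t - (x0 - x0)) with (X t - Y t) in E by ring.
  assert (0 <= e * d) by (apply Rmult_le_pos; lra). nra.
Qed.

Definition clamp (lo hi y : R) : R := Rmin hi (Rmax lo y).

Lemma clamp_bounds (lo hi y : R) : lo <= hi -> lo <= clamp lo hi y <= hi.
Proof.
  intros H. unfold clamp. split; [|apply Rmin_l].
  apply Rmin_glb; [exact H|apply Rmax_l].
Qed.

Lemma clamp_id (lo hi y : R) : lo <= y <= hi -> clamp lo hi y = y.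
Proof. intros H. unfold clamp. rewrite Rmax_right, Rmin_right; lra. Qed.

Lemma continuous_clamp (lo hi t : R) : continuous (clamp lo hi) t.
Proof.
  apply (continuous_comp (Rmax lo) (Rmin hi)).
  - apply continuous_Rmax_l.
  - apply continuous_Rmin_l.
Qed.

Lemma clamp_nonexpansive (lo hi a b : R) :
  Rabs (clamp lo hi a - clamp lo hi b) <= Rabs (a - b).
Proof.
  unfold clamp, Rmin, Rmax, Rabs. destruct (Rle_dec lo a), (Rle_dec lo b).
  all: repeat match goal with |- context [Rle_dec ?p ?q] => destruct (Rle_dec p q) end.
  all: repeat match goal with |- context [Rcase_abs ?p] => destruct (Rcase_abs p) end; lra.
Qed.

(** The integral operator composed with the clamping of time between [T] and [T + d]:
    this keeps all functions defined on the whole line, while distances are measured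
    between [T] and [T + d] only. *)
Lemma picard (h : R -> R -> R) (T xi eta L : R) :
  (forall t y1 y2, Rabs (h t y1 - h t y2) <= L * Rabs (y1 - y2)) ->
  (forall z : R -> R, (forall t, continuous z t) -> forall t, continuous (fun t => h t (z t)) t) ->
  exists d, 0 < d /\ exists Z Zp Zq : R -> R, C2_below p_infty Z Zp Zq /\
    Z T = xi /\ Zp T = eta /\ forall t, T <= t <= T + d -> Zq t = h t (Z t).
Proof.
  intros HL Hc.
  assert (L0 : 0 <= L).
  { assert (H := HL 0 1 0). rewrite Rminus_0_r, Rabs_R1 in H.
    generalize (Rabs_pos (h 0 1 - h 0 0)). lra. }
  (* small enough for the ratio L * d * d to be at most 1/2 *)
  set (d := / (2 * (L + 1))).
  assert (d0 : 0 < d) by (apply Rinv_0_lt_compat; lra).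
  assert (dL : L * d * d <= / 2).
  { assert (E : d * (2 * (L + 1)) = 1) by (apply Rinv_l; lra). nra. }
  set (kappa := clamp T (T + d)).
  assert (Hk : forall t, T <= kappa t <= T + d) by (intros t; apply clamp_bounds; lra).
  set (Y := fun z : R -> R => double_primitive T xi eta (fun t => h t (z t))).
  assert (cY : forall z : R -> R, (forall t, continuous z t) -> forall t, continuous (Y z) t).
  { intros z cz t. destruct (C2_below_double_primitive T p_infty xi eta (fun t => h t (z t)) I
      (fun t _ => Hc z cz t)) as [C _].
    exact (is_derive_R_continuous _ _ _ (proj1 (C t I))). }
  set (Phi := fun z t => Y z (kappa t)).
  assert (cPhi : forall z : R -> R, (forall t, continuous z t) -> forall t, continuous (Phi z) t).
  { intros z cz t. apply (continuous_comp kappa (Y z)); [apply continuous_clamp|auto]. }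
  assert (cxi : forall t : R, continuous (fun _ : R => xi) t)
    by (intros; apply continuous_const).
  (* the first Picard step is bounded, by continuity on the compact [T, T + d] *)
  destruct (continuity_ab_maj (fun t => Rabs (Y (fun _ => xi) t - xi)) T (T + d)) as [m [Hm _]].
  { lra. }
  { intros t _. apply continuity_pt_filterlim.
    apply (continuous_Rabs_comp (fun t => Y (fun _ => xi) t - xi)).
    apply (continuous_minus (V := R_NormedModule) (Y (fun _ => xi)) (fun _ : R => xi));
      [now apply cY|apply cxi]. }
  destruct (contraction_fixed_point Phi (fun _ => xi)
    (Rabs (Y (fun _ => xi) m - xi)) cPhi) as [z [cz Hz]].
  - intros y z e cy cz He t. unfold Phi, Y.
    eapply Rle_trans; [apply (double_primitive_contraction T d xi eta (L * e)); auto|].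
    + intros s. eapply Rle_trans; [apply HL|]. now apply Rmult_le_compat_l.
    + assert (0 <= e) by (eapply Rle_trans; [apply Rabs_pos|apply (He 0)]). nra.
  - exact cxi.
  - intros t. unfold Phi. apply (Hm (kappa t)), Hk.
  - destruct (C2_below_double_primitive T p_infty xi eta (fun t => h t (z t)) I
      (fun t _ => Hc z cz t)) as [C [HX HP]].
    exists d. split; [exact d0|]. do 3 eexists. split; [exact C|split; [exact HX|split; [exact HP|]]].
    intros t Ht. simpl. f_equal. rewrite <- Hz. unfold Phi, kappa. now rewrite clamp_id.
Qed.

Lemma continuous_pair (y z : R -> R) (t : R) :
  continuous y t -> continuous z t -> continuous (fun s => (y s, z s)) t.
Proof.
  intros Hy Hz. apply filterlim_locally. intros eps.
  generalize (filter_and _ _ (proj1 (filterlim_locally _ _) Hy eps)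
    (proj1 (filterlim_locally _ _) Hz eps)).
  apply filter_imp. intros s [H1 H2]. now split.
Qed.

(** Only the local Lipschitz property of [f] is available, near the point [(T, xi / T)] where
    [Derive (f T)] is bounded by continuity. The right-hand side is therefore replaced by
    one where both [t] and [y / t] are clamped to a box around that point; it is globally
    Lipschitz, and its solution stays in the box for a short time, during which it solves
    the original equation. *)
Lemma local_existence (f : R -> R -> R) (t0 T xi eta : R) :
  1 <= t0 < T ->
  continuous_on (fun p : R * R => t0 <= fst p) (fun p : R * R => f (fst p) (snd p)) ->
  (forall t v : R, t0 <= t -> ex_derive (f t) v) ->
  continuous_on (fun p : R * R => t0 <= fst p)
    (fun p : R * R => Derive (f (fst p)) (snd p)) ->
  exists d, 0 < d /\ exists Z Zp Zq : R -> R, C2_below p_infty Z Zp Zq /\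
    Z T = xi /\ Zp T = eta /\
    forall t, T <= t < T + d -> Zq t = - f t (Z t / t).
Proof.
  intros HT fc fd dfc.
  set (v := xi / T).
  assert (DT : t0 <= T) by lra.
  assert (dfT := proj1 (filterlim_locally _ _) (dfc (T, v) DT) (mkposreal 1 Rlt_0_1)).
  destruct dfT as [[r r0] Hr]. simpl in Hr.
  set (L := Rabs (Derive (f T) v) + 1).
  assert (HL : forall t y, T <= t <= T + r / 2 -> v - r / 2 <= y <= v + r / 2 ->
    Rabs (Derive (f t) y) <= L).
  { intros t y Ht Hy.
    assert (E : Rabs (Derive (f t) y - Derive (f T) v) < 1).
    { apply (Hr (t, y)); [|simpl; lra].
      split; apply Rabs_lt_between; unfold minus, plus, opp; simpl; lra. }
    unfold L. replace (Derive (f t) y) with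
      (Derive (f T) v + (Derive (f t) y - Derive (f T) v)) by ring.
    eapply Rle_trans; [apply Rabs_triang|lra]. }
  set (tau := clamp T (T + r / 2)).
  set (pi := clamp (v - r / 2) (v + r / 2)).
  assert (Htau : forall t, T <= tau t <= T + r / 2) by (intros t; apply clamp_bounds; lra).
  assert (Hpi : forall y, v - r / 2 <= pi y <= v + r / 2) by (intros y; apply clamp_bounds; lra).
  set (h := fun t y => - f (tau t) (pi (y / tau t))).
  destruct (picard h T xi eta L) as [d [d0 [Z [Zp [Zq [HC [HZ [HZp HZq]]]]]]]].
  - assert (W : forall t a b, a <= b -> T <= t <= T + r / 2 -> v - r / 2 <= a -> b <= v + r / 2 ->
      Rabs (f t b - f t a) <= L * (b - a)).
    { intros t a b Hab Ht Ha Hb. replace (L * (b - a)) with (L * b - L * a) by ring.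
      apply (derive_domination (f t) (Derive (f t)) (fun y => L * y) (fun _ => L)); auto.
      - intros y Hy. apply Derive_correct, fd. lra.
      - intros y Hy. auto_derive; [exact I|ring].
      - intros y Hy. apply HL; auto; lra. }
    assert (W' : forall t a b, T <= t <= T + r / 2 -> v - r / 2 <= a <= v + r / 2 ->
      v - r / 2 <= b <= v + r / 2 -> Rabs (f t b - f t a) <= L * Rabs (b - a)).
    { intros t a b Ht Ha Hb. destruct (Rle_lt_dec a b).
      - rewrite (Rabs_pos_eq (b - a)) by lra. apply W; auto; lra.
      - rewrite (Rabs_minus_sym (f t b)), (Rabs_minus_sym b), (Rabs_pos_eq (a - b)) by lra.
        apply W; auto; lra. }
    assert (L0 : 0 <= L) by (unfold L; generalize (Rabs_pos (Derive (f T) v)); lra).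
    intros t y1 y2. unfold h.
    replace (- f (tau t) (pi (y1 / tau t)) - - f (tau t) (pi (y2 / tau t)))
      with (f (tau t) (pi (y2 / tau t)) - f (tau t) (pi (y1 / tau t))) by ring.
    eapply Rle_trans; [apply W'; auto|]. apply Rmult_le_compat_l; [exact L0|].
    eapply Rle_trans; [apply clamp_nonexpansive|].
    rewrite (Rabs_minus_sym y1).
    specialize (Htau t). replace (y2 / tau t - y1 / tau t) with ((y2 - y1) * / tau t) by (field; lra).
    rewrite Rabs_mult. rewrite <- (Rmult_1_r (Rabs (y2 - y1))) at 2.
    apply Rmult_le_compat_l; [apply Rabs_pos|].
    rewrite Rabs_pos_eq; [|apply Rlt_le, Rinv_0_lt_compat; lra].
    rewrite <- Rinv_1. apply Rinv_le_contravar; lra.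
  - intros z cz t.
    apply (continuous_opp (V := R_NormedModule) (fun t : R => f (tau t) (pi (z t / tau t)))).
    apply (continuous_on_comp (fun p : R * R => t0 <= fst p) (fun p : R * R => f (fst p) (snd p))
      (fun t => (tau t, pi (z t / tau t)))); [exact fc| | |].
    + apply continuous_pair; [apply continuous_clamp|].
      apply (continuous_comp (fun t => z t / tau t) pi).
      * apply (continuous_mult z (fun t => / tau t)); [apply cz|].
        apply (continuous_comp tau Rinv); [apply continuous_clamp|]. apply continuous_Rinv.
        specialize (Htau t). lra.
      * apply continuous_clamp.
    + simpl. specialize (Htau t). lra.
    + apply filter_forall. intros s. simpl. specialize (Htau s). lra.
  - assert (Hnear : continuous (fun t => Z t / t) T).
    { apply (continuous_mult Z Rinv); [|apply continuous_Rinv; lra].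
      exact (is_derive_R_continuous _ _ _ (proj1 (HC T I))). }
    assert (r2 : 0 < r / 2) by lra.
    destruct (proj1 (filterlim_locally _ _) Hnear (mkposreal _ r2)) as [[e e0] He]. simpl in He.
    exists (Rmin (Rmin d e) (r / 2)). split; [repeat apply Rmin_pos; lra|].
    exists Z, Zp, Zq. split; [exact HC|split; [exact HZ|split; [exact HZp|]]].
    intros t Ht.
    assert (t < T + d /\ t < T + e /\ t < T + r / 2) as [Hd [Hte Htr]].
    { generalize (Rmin_l (Rmin d e) (r / 2)) (Rmin_r (Rmin d e) (r / 2)) (Rmin_l d e) (Rmin_r d e).
      lra. }
    rewrite HZq by lra. unfold h.
    replace (tau t) with t by (symmetry; apply clamp_id; lra).
    assert (E : Rabs (Z t / t - Z T / T) < r / 2).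
    { apply He. apply Rabs_lt_between; unfold minus, plus, opp; simpl; lra. }
    rewrite HZ in E. apply Rabs_lt_between in E. fold v in E.
    unfold pi. rewrite clamp_id by lra. reflexivity.
Qed.

Lemma is_derive_glue (y z : R -> R) (T l : R) :
  is_derive y T l -> is_derive z T l -> y T = z T ->
  is_derive (fun t => if Rle_dec t T then y t else z t) T l.
Proof.
  intros [Hl Hy] [_ Hz] E. split; [exact Hl|]. intros s Hs eps.
  assert (s = T) by (symmetry; apply (is_filter_lim_locally_unique (V := R_NormedModule)); exact Hs).
  subst s. generalize (filter_and _ _ (Hy T Hs eps) (Hz T Hs eps)).
  apply filter_imp. intros t [H1 H2].
  destruct (Rle_dec T T) as [_|n]; [|now destruct n; apply Rle_refl].
  destruct (Rle_dec t T); [exact H1|]. now rewrite E.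
Qed.

Lemma continuous_glue (y z : R -> R) (T t : R) :
  (forall t, continuous y t) -> (forall t, continuous z t) -> y T = z T ->
  continuous (fun t => if Rle_dec t T then y t else z t) t.
Proof.
  intros Hy Hz E.
  destruct (Rtotal_order t T) as [H|[->|H]].
  - apply (continuous_ext_loc _ y); [|apply Hy].
    apply (locally_interval _ t m_infty T); simpl; auto. intros s _ Hs.
    destruct (Rle_dec s T); [reflexivity|lra].
  - apply filterlim_locally. intros eps.
    generalize (filter_and _ _ (proj1 (filterlim_locally _ _) (Hy T) eps)
      (proj1 (filterlim_locally _ _) (Hz T) eps)).
    apply filter_imp. intros s [H1 H2].
    destruct (Rle_dec T T) as [_|n]; [|now destruct n; apply Rle_refl].
    destruct (Rle_dec s T); [exact H1|]. now rewrite E.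
  - apply (continuous_ext_loc _ z); [|apply Hz].
    apply (locally_interval _ t T p_infty); simpl; auto. intros s Hs _.
    destruct (Rle_dec s T); [lra|reflexivity].
Qed.

(** The right and left derivatives of each order agree at [T], so the function glued from
    [X] on the left and [Z] on the right is of class C2. *)
Lemma C2_below_glue (T : R) (X P Q Z S U : R -> R) :
  C2_below p_infty X P Q -> C2_below p_infty Z S U ->
  X T = Z T -> P T = S T -> Q T = U T ->
  exists Y V W : R -> R, C2_below p_infty Y V W /\
    (forall t, t <= T -> Y t = X t /\ V t = P t /\ W t = Q t) /\
    (forall t, T < t -> Y t = Z t /\ V t = S t /\ W t = U t).
Proof.
  intros H1 H2 EX EP EQ.
  assert (dg : forall y z dy dz : R -> R, (forall t, is_derive y t (dy t)) ->
    (forall t, is_derive z t (dz t)) -> y T = z T -> dy T = dz T -> forall t,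
    is_derive (fun t => if Rle_dec t T then y t else z t) t (if Rle_dec t T then dy t else dz t)).
  { intros y z dy dz Hy Hz E E' t. destruct (Rtotal_order t T) as [H|[->|H]].
    - destruct (Rle_dec t T) as [_|]; [|lra].
      apply (is_derive_ext_loc y); [|apply Hy].
      apply (locally_interval _ t m_infty T); simpl; auto. intros s _ Hs.
      destruct (Rle_dec s T); [reflexivity|lra].
    - destruct (Rle_dec T T) as [_|n]; [|now destruct n; apply Rle_refl].
      apply is_derive_glue; auto. rewrite E'. apply Hz.
    - destruct (Rle_dec t T) as [|_]; [lra|].
      apply (is_derive_ext_loc z); [|apply Hz].
      apply (locally_interval _ t T p_infty); simpl; auto. intros s Hs _.
      destruct (Rle_dec s T); [lra|reflexivity]. }
  exists (fun t => if Rle_dec t T then X t else Z t), (fun t => if Rle_dec t T then P t else S t),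
    (fun t => if Rle_dec t T then Q t else U t).
  split; [|split].
  - intros t _. split; [|split].
    + apply dg; auto; intros s; [apply (H1 s I)|apply (H2 s I)].
    + apply dg; auto; intros s; [apply (H1 s I)|apply (H2 s I)].
    + apply continuous_glue; auto; intros s; [apply (H1 s I)|apply (H2 s I)].
  - intros t Ht. destruct (Rle_dec t T); [easy|lra].
  - intros t Ht. destruct (Rle_dec t T); [lra|easy].
Qed.

(** * Continuation and conclusion *)

Lemma C2_below_solution (f : R -> R -> R) (t0 : R) (T : Rbar) (X P Q : R -> R) :
  Rbar_lt t0 T -> C2_below T X P Q ->
  (forall t, Ico t0 T t -> Q t = - f t (X t / t)) -> solution f t0 T X.
Proof.
  intros H0 HC HQ. split; [exact H0|]. exists P, Q.
  split; [split; [|split]|].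
  - intros t Ht. apply is_derive_is_derive_within; [exact Ht|]. apply HC, Ht.
  - intros t Ht. apply is_derive_is_derive_within; [exact Ht|]. apply HC, Ht.
  - intros t Ht. eapply filterlim_filter_le_1; [apply filter_le_within|].
    apply HC, Ht.
  - intros t Ht. rewrite HQ by exact Ht. ring.
Qed.

(** The bound on [u = t X' - X] makes [v = X / t] Lipschitz up to [T], so [v] has a
    limit [vT] there. The right-hand side along the solution, continued by [vT] beyond [T], is then
    continuous on the whole line, and integrating it twice prolongs [X] to a C2 function
    past [T]. Its value and derivative at [T] are the initial data of a local solution, to
    which it is glued. *)
Lemma continuation (f : R -> R -> R) (t0 T M : R) (X P Q : R -> R) :
  1 <= t0 < T ->
  continuous_on (fun p : R * R => t0 <= fst p) (fun p : R * R => f (fst p) (snd p)) ->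
  (forall t v : R, t0 <= t -> ex_derive (f t) v) ->
  continuous_on (fun p : R * R => t0 <= fst p)
    (fun p : R * R => Derive (f (fst p)) (snd p)) ->
  C2_below T X P Q ->
  (forall t, Ico t0 T t -> Q t = - f t (X t / t)) ->
  (forall t, Ico t0 T t -> Rabs (t * P t - X t) <= M) ->
  exists T' Y, T < T' /\ solution f t0 T' Y /\ forall t, Ico t0 T t -> Y t = X t.
Proof.
  intros HT fc fd dfc HC HQ HM.
  set (v := fun t => X t / t).
  assert (Hv : forall t, Ico t0 T t -> is_derive v t ((t * P t - X t) / t ^ 2)).
  { intros t [Ht HtT]. apply (C2_below_radial T X P Q); auto; lra. }
  assert (Hnear : at_left T (fun t => Ico t0 T t)).
  { assert (HL : locally T (fun t => t0 < t)) by now apply open_gt.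
    unfold at_left, within. revert HL. apply filter_imp. intros t H1 H2. split; simpl; lra. }
  destruct (cauchy_of_domination (at_left T) (Ico t0 T) v (fun t => - (M / t)) (- (M / T)))
    as [vT HvT]; [apply at_left_proper_filter|exact Hnear| | |].
  { intros s t Hs Ht Hst.
    assert (Hr : forall r, s <= r <= t -> Ico t0 T r).
    { intros r Hr. destruct Hs, Ht. split; simpl in *; lra. }
    apply (derive_domination v (fun r => (r * P r - X r) / r ^ 2) (fun t => - (M / t))
      (fun r => M / r ^ 2)); auto; intros r Hrr; specialize (Hr r Hrr); specialize (HM r Hr);
      destruct Hr as [Hr _].
    - auto_derive; [lra|field; lra].
    - unfold Rdiv at 1. rewrite Rabs_mult.
      assert (0 < / r ^ 2) by (apply Rinv_0_lt_compat; nra).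
      rewrite (Rabs_pos_eq (/ r ^ 2)) by lra. apply Rmult_le_compat_r; lra. }
  { eapply filterlim_filter_le_1; [apply filter_le_within|].
    apply (ex_derive_continuous (fun t => - (M / t))). auto_derive. lra. }
  set (V := fun t => if Rlt_dec t T then v (Rmax t0 t) else vT).
  assert (HV : forall t, Ico t0 T t -> V t = v t).
  { intros t [Ht HtT]; simpl in HtT. unfold V. destruct (Rlt_dec t T); [|lra].
    now rewrite Rmax_right. }
  assert (cV : forall t, continuous V t).
  { intros t. destruct (Rtotal_order t T) as [H|[->|H]].
    - apply (continuous_ext_loc _ (fun t => v (Rmax t0 t))).
      + apply (locally_interval _ t m_infty T); simpl; auto. intros s _ Hs.
        unfold V. destruct (Rlt_dec s T); [reflexivity|lra].
      + apply (continuous_comp (Rmax t0) v); [apply continuous_Rmax_l|].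
        eapply is_derive_R_continuous, Hv. split; [apply Rmax_l|]. simpl. apply Rmax_lub_lt; lra.
    - unfold V. apply filterlim_locally. intros eps.
      destruct (Rlt_dec T T) as [n|_]; [lra|].
      assert (H1 := filter_and _ _ Hnear (proj1 (filterlim_locally _ _) HvT eps)).
      unfold at_left, within in H1. revert H1. apply filter_imp. intros s Hs.
      destruct (Rlt_dec s T) as [Hlt|].
      + destruct (Hs Hlt) as [[Hs0 _] Hb]. now rewrite Rmax_right.
      + apply ball_center.
    - apply (continuous_ext_loc _ (fun _ => vT)); [|apply continuous_const].
      apply (locally_interval _ t T p_infty); simpl; auto. intros s Hs _.
      unfold V. destruct (Rlt_dec s T); [lra|reflexivity]. }
  set (q := fun t => - f (Rmax t0 t) (V t)).
  assert (cq : forall t, continuous q t).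
  { intros t. apply (continuous_opp (V := R_NormedModule) (fun t : R => f (Rmax t0 t) (V t))).
    apply (continuous_on_comp (fun p : R * R => t0 <= fst p) (fun p : R * R => f (fst p) (snd p))
      (fun t => (Rmax t0 t, V t))); [exact fc| | |].
    - apply continuous_pair; [apply continuous_Rmax_l|apply cV].
    - apply Rmax_l.
    - apply filter_forall. intros s. apply Rmax_l. }
  destruct (C2_below_double_primitive t0 p_infty (X t0) (P t0) q I (fun t _ => cq t))
    as [HC1 [EX EP]].
  revert HC1 EX EP. set (X1 := double_primitive _ _ _ _). set (P1 := fun t => P t0 + RInt q t0 t).
  intros HC1 EX EP. change (P1 t0 = P t0) in EP.
  assert (Eq : forall t, Ico t0 T t -> q t = Q t).
  { intros t Ht. unfold q. rewrite HQ, HV by exact Ht. rewrite Rmax_right by apply Ht. reflexivity. }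
  assert (EP1 : forall t, Ico t0 T t -> P1 t = P t).
  { intros t [Ht HtT]. apply (eq_of_derive_eq P1 P Q t0 t); auto; intros s Hs;
      assert (Hs' : Ico t0 T s) by now apply Ico_between with t.
    - rewrite <- Eq by exact Hs'. apply (HC1 s I).
    - apply HC, Hs'. }
  assert (EX1 : forall t, Ico t0 T t -> X1 t = X t).
  { intros t [Ht HtT]. apply (eq_of_derive_eq X1 X P t0 t); auto; intros s Hs;
      assert (Hs' : Ico t0 T s) by now apply Ico_between with t.
    - rewrite <- EP1 by exact Hs'. apply (HC1 s I).
    - apply HC, Hs'. }
  assert (EvT : X1 T / T = vT).
  { apply (filterlim_locally_unique (F := at_left T) v); [|exact HvT].
    apply (filterlim_ext_loc (fun t => X1 t / t)).
    - revert Hnear. apply filter_imp. intros t Ht. unfold v. now rewrite EX1.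
    - eapply filterlim_filter_le_1; [apply filter_le_within|].
      apply (is_derive_R_continuous (fun t => X1 t / t) T ((T * P1 T - X1 T) / T ^ 2)).
      apply (C2_below_radial p_infty X1 P1 q); auto; [lra|exact I]. }
  destruct (local_existence f t0 T (X1 T) (P1 T) HT fc fd dfc)
    as [d [d0 [Z [S [U [HCZ [EZ [ES EU]]]]]]]].
  destruct (C2_below_glue T X1 P1 q Z S U HC1 HCZ) as [Y [Y' [Y'' [HCY [Hle Hgt]]]]]; auto.
  { rewrite EU by lra. unfold q, V. destruct (Rlt_dec T T); [lra|].
    rewrite Rmax_right, EZ, EvT by lra. reflexivity. }
  exists (T + d), Y. split; [lra|split].
  - apply (C2_below_solution f t0 (T + d) Y Y' Y''); [simpl; lra|intros t _; apply (HCY t I)|].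
    intros t [Ht HtT]. simpl in HtT. destruct (Rle_lt_dec t T) as [Htle|Htgt].
    + destruct (Hle t Htle) as [-> [_ ->]]. unfold q. rewrite Rmax_right by exact Ht.
      f_equal. f_equal. destruct (Rlt_dec t T) as [Hlt|Hnlt].
      * assert (Ht' : Ico t0 T t) by now split. rewrite HV, EX1 by exact Ht'. reflexivity.
      * replace t with T by lra. rewrite EvT. unfold V. destruct (Rlt_dec T T); [lra|reflexivity].
    + destruct (Hgt t Htgt) as [-> [_ ->]]. apply EU. lra.
  - intros t Ht. rewrite <- EX1 by exact Ht. apply Hle. destruct Ht as [_ Ht]. simpl in Ht. lra.
Qed.

Lemma little_o_pinfty_ext (t0 : R) (y z w : R -> R) :
  (forall t, t0 <= t -> y t = z t) -> little_o_pinfty y w -> little_o_pinfty z w.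
Proof.
  intros E H eps.
  assert (Hnear : Rbar_locally p_infty (fun t => t0 <= t)) by (exists t0; intros; lra).
  generalize (filter_and _ _ Hnear (H eps)). apply filter_imp.
  intros t [Ht Ho]. now rewrite <- E.
Qed.

Theorem theorem1 (t0 : R) (f : R -> R -> R) (a g : R -> R) (K : R)
  (ht0 : 1 <= t0)
  (f_cont : continuous_on (fun p : R * R => t0 <= fst p)
              (fun p : R * R => f (fst p) (snd p)))
  (f_derivable : forall t v : R, t0 <= t -> ex_derive (f t) v)
  (df_cont : continuous_on (fun p : R * R => t0 <= fst p)
               (fun p : R * R => Derive (f (fst p)) (snd p)))
  (f_sign : forall t v, t0 <= t -> v * f t v <= 0)
  (df_sign : forall t v, t0 <= t -> Derive (f t) v <= 0)
  (f_bound : forall t v, t0 <= t -> Rabs (f t v) <= a t * g (Rabs v))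
  (a_ge0 : forall t, t0 <= t -> 0 <= a t)
  (a_cont : continuous_on (fun t : R => t0 <= t) a)
  (g_ge0 : forall s, 0 <= s -> 0 <= g s)
  (g_cont : continuous_on (fun s : R => 0 <= s) g)
  (g_gt0 : forall s, 0 < s -> 0 < g s)
  (g_nondecr : forall r s, 0 <= r -> r <= s -> g r <= g s)
  (hK : is_RInt_gen (fun t => t * a t) (at_point t0) (Rbar_locally p_infty) K)
  (hg : ex_RInt_gen (fun s => 1 / g s) (at_point 1) (Rbar_locally p_infty))
  (x : R -> R) (T : Rbar) (hx : maximal_solution f t0 T x)
  (dx0 : R) (hdx0 : is_derive_within (Ico t0 T) x t0 dx0) :
  let u0 := t0 * dx0 - x t0 in
  let v0 := x t0 / t0 in
  let c := 1 + u0 ^ 2 / 2 in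
  4 / t0 * (K + c / g 1)
    < RInt_gen (fun s => 1 / g s) (at_point (1 + Rabs v0))
        (Rbar_locally p_infty) ->
  T = p_infty /\
  (little_o_pinfty x (fun t => t) \/
   exists x1 x2 : R, x1 <> 0 /\
     little_o_pinfty (fun t => x t - (x1 * t + x2)) (fun _ => 1)).
Proof.
  intros u0 v0 c Hlt.
  destruct hx as [[H0 [dx [ddx [HC2 Heq]]]] Hmax].
  assert (Ht0 : Ico t0 T t0) by (split; [apply Rle_refl|exact H0]).
  assert (Edx : dx t0 = dx0).
  { apply (is_derive_within_Ico_unique t0 T x); auto. now apply (proj1 HC2). }
  destruct (C2_extension_left t0 T x dx ddx H0 HC2) as [X [P [Q [HC HE]]]].
  assert (HQ : forall t, Ico t0 T t -> Q t = - f t (X t / t)).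
  { intros t Ht. destruct (HE t Ht) as [-> [_ ->]]. specialize (Heq t Ht). lra. }
  assert (HQb : forall t, Ico t0 T t -> Rabs (Q t) <= a t * g (Rabs (X t / t))).
  { intros t Ht. rewrite HQ by exact Ht. rewrite Rabs_Ropp. apply f_bound, Ht. }
  assert (HK : 0 <= K).
  { destruct (weight_primitive t0 K a ht0 a_ge0 a_cont hK) as [A [A0 [_ [_ HA]]]].
    rewrite <- A0. apply HA, Rle_refl. }
  destruct (a_priori_bound t0 T a g K X P Q) as [W [M HWM]]; auto.
  { destruct (HE t0 Ht0) as [-> [-> _]]. rewrite Edx.
    eapply Rle_lt_trans; [|exact Hlt]. fold u0 c.
    assert (0 < c / g 1).
    { apply Rdiv_lt_0_compat; [unfold c; generalize (pow2_ge_0 u0); lra|apply g_gt0; lra]. }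
    assert (0 < / t0) by (apply Rinv_0_lt_compat; lra).
    (* the factor 4 of the hypothesis is weakened to 1 *)
    unfold Rdiv at 2. rewrite Rmult_assoc.
    assert (0 <= / t0 * (K + c / g 1)) by (apply Rmult_le_pos; lra). lra. }
  destruct T as [T| |]; [exfalso| |now destruct H0].
  - destruct (continuation f t0 T M X P Q) as [T' [Y [HT' [HY HYX]]]]; auto.
    { intros t Ht. now apply HWM. }
    apply (Hmax T' Y HT' HY). intros t Ht. rewrite HYX by exact Ht. now apply HE.
  - split; [reflexivity|].
    assert (HX : forall t, t0 <= t -> X t = x t) by (intros t Ht; now apply HE).
    assert (HI : forall t, t0 <= t -> Ico t0 p_infty t) by now split.
    destruct (asymptotics t0 K W M a g X P Q) as [Ho|[x1 [x2 [Hx1 Ho]]]]; auto.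
    + left. now apply (little_o_pinfty_ext t0 X).
    + right. exists x1, x2. split; [exact Hx1|].
      apply (little_o_pinfty_ext t0 (fun t => X t - (x1 * t + x2))); [|exact Ho].
      intros t Ht. now rewrite HX.
Qed.
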